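(* Let $n=2$, let $A\in\mathbb{R}^{2\times 2}$ be symmetric positive definite with smallest and largest eigenvalues $\lambda_1\le\lambda_n$, let $b\in\mathbb{R}^2$, and consider a gradient method $x_{j+1}=x_j-\alpha_j g_j$ with the invariance property under orthogonal transformations applied to $\min_{x\in\mathbb{R}^2} q(x)=\frac12 x^{\sf T}Ax-b^{\sf T}x$, where $g_j=\nabla q(x_j)=Ax_j-b$. Let $\nu_1(k),\nu_2(k)\in\{1,\ldots,k\}$, and let $\psi_1,\psi_2,\psi_3,\psi_4$ be admissible functions (as defined in the context) with $\psi_1(z)\psi_2(z)=\psi_3(z)\psi_4(z)$ for all $z\in[\lambda_1,\lambda_n]$. If the stepsize $\alpha_k$ solves the quadratic equation $$g_{\nu_1(k)}^{\sf T}\psi_1(A)(I-\alpha_kA)g_{k}\cdot g_{\nu_2(k)}^{\sf T}\psi_2(A)(I-\alpha_kA)g_{k} =g_{\nu_1(k)}^{\sf T}\psi_3(A)(I-\alpha_kA)g_{k}\cdot g_{\nu_2(k)}^{\sf T}\psi_4(A)(I-\alpha_kA)g_{k},$$ and if the stepsize $\alpha_{k+2}$ is of the form $$\alpha_{k+2}=\frac{(A^{\mu} g_{k+i})^{\sf T}(A^{\mu} g_{k+i})}{(A^{\mu} g_{k+i})^{\sf T}A(A^{\mu} g_{k+i})},\quad\text{where } i=1 \text{ or } 2$$ and $\mu$ is some real number, then $g_{k+i}=0$ for some $1\le i\le 3$.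
   Context: A function $\psi$ is called admissible here if it is real analytic on $[\lambda_1,\lambda_n]$ and can be expressed by a Laurent series $\psi(z)=\sum_{j=-\infty}^{\infty}c_jz^j$ with $c_j\in\mathbb{R}$ such that $0<\sum_{j=-\infty}^{\infty}c_jz^j<+\infty$ for all $z\in[\lambda_1,\lambda_n]$; $\psi(A)$ denotes $\sum_j c_jA^j$, i.e. the usual matrix function of the symmetric matrix $A$. $A^\mu$ is the usual real power of the positive definite matrix $A$, and $I$ is the identity matrix. The gradient method has the invariance property under orthogonal transformations if, for every orthogonal matrix $Q$, applying the method to $\hat q(y)=q(Q^{\sf T}y)$ from $y_1=Qx_1$ gives the iterates $y_j=Qx_j$ with the same stepsizes. The requirement on $\alpha_{k+2}$ is understood to be imposed when $g_{k+1}$ and $g_{k+2}$ are nonzero (otherwise the conclusion already holds).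
   Formalization: The equation for α_k is required to be genuinely quadratic (nonzero coefficient of α_k²) unless g_k is zero or an eigenvector of A; otherwise it may be the identity 0=0 (e.g. all ψ_i=1), α_k is unconstrained and the claim fails. *)

(* Defs.v *)
From HB Require Import structures.
From mathcomp Require Import all_boot all_order all_algebra.
From mathcomp Require Import all_classical all_reals all_analysis.
From mathcomp Require Import ring.

Set Implicit Arguments.
Unset Strict Implicit.
Unset Printing Implicit Defensive.

Import Order.TTheory GRing.Theory Num.Theory.
Import numFieldNormedType.Exports.

Local Open Scope classical_set_scope.
Local Open Scope ring_scope.

Section LinearAlgebra.
Context {R : realType} {n : nat}.
Implicit Types (A Q : 'M[R]_n.+1) (b x u v : 'cV[R]_n.+1).

Definition dotv u v : R := (u^T *m v) 0 0.

Definition spd A : Prop :=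
  A^T = A /\ forall x, x != 0 -> 0 < dotv x (A *m x).

Definition orthogonal_mx Q : Prop := Q^T *m Q = 1%:M.

Definition extreme_eigenvalues A (lo hi : R) : Prop :=
  [/\ eigenvalue A lo, eigenvalue A hi &
      forall l, eigenvalue A l -> lo <= l <= hi].

(* The spectral definition of A ^ mu: all orthonormal eigenbases of A give the
   same matrix, and one exists whenever A is symmetric positive definite, so
   the default value of [xget] is never reached in that case. *)
Definition is_rpowmx A (mu : R) : set 'M[R]_n.+1 :=
  [set B | exists (P : 'M[R]_n.+1) (d : 'rV[R]_n.+1),
     [/\ orthogonal_mx P, forall i, 0 < d 0 i,
         A = P^T *m diag_mx d *m P &
         B = P^T *m diag_mx (map_mx (fun t => t `^ mu) d) *m P]].

Definition rpowmx A (mu : R) : 'M[R]_n.+1 := xget 0 (is_rpowmx A mu).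

Definition quad A b x : R := 2^-1 * dotv x (A *m x) - dotv b x.

Definition gradient (f : 'cV[R]_n.+1 -> R) x : 'cV[R]_n.+1 :=
  \col_i 'D_(delta_mx i 0) (f : 'cV[R]_n.+1 -> R^o) x.

Lemma gradient_quad A b x : A^T = A -> gradient (quad A b) x = A *m x - b.
Proof.
move=> symA.
have dotDl u v w : dotv (u + v) w = dotv u w + dotv v w.
  by rewrite /dotv linearD mulmxDl mxE.
have dotDr u v w : dotv u (v + w) = dotv u v + dotv u w.
  by rewrite /dotv mulmxDr mxE.
have dotZl (h : R) u w : dotv (h *: u) w = h * dotv u w.
  by rewrite /dotv linearZ -scalemxAl mxE.
have dotZr (h : R) u w : dotv u (h *: w) = h * dotv u w.
  by rewrite /dotv -scalemxAr mxE.
have dotC u w : dotv u w = dotv w u.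
  by rewrite /dotv -[u^T *m w]trmxK trmx_mul trmxK mxE.
have dotA u w : dotv u (A *m w) = dotv w (A *m u).
  by rewrite dotC /dotv trmx_mul symA mulmxA.
apply/colP => i; rewrite !mxE.
set v := delta_mx i 0.
pose s : R := dotv v (A *m x) - dotv b v.
have -> : (\sum_j A i j * x j 0) - b i 0 = s.
  rewrite /s [dotv b v]dotC /dotv !trmx_delta -!rowE !mxE //.
apply: cvg_lim => //.
have E : {near 0^', (fun h : R => s + h * (2^-1 * dotv v (A *m v))) =1
   (fun h : R => h^-1 *: ((quad A b \o shift x) (h *: v) - quad A b x) : R^o)}.
  near=> h; have h0 : h != 0 by near: h; exact: nbhs_dnbhs_neq.
  rewrite /= /quad mulmxDr -scalemxAr !dotDl !dotDr !dotZl !dotZr (dotA x v).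
  by rewrite /s /GRing.scale /=; field.
have K : (fun h : R => s + h * (2^-1 * dotv v (A *m v)) : R^o) @ 0^' -->
    (s : R^o).
  apply: cvg_trans (_ : (fun h : R => s + h * (2^-1 * dotv v (A *m v)) : R^o) @
    nbhs (0 : R) --> (s : R^o)); first by apply: cvg_app; exact: nbhs_dnbhs.
  rewrite -[X in _ --> X]addr0 -[X in _ + X](mul0r (2^-1 * dotv v (A *m v))).
  by apply: cvgD; [exact: cvg_cst | apply: cvgMl; exact: cvg_id].
exact: cvg_trans (near_eq_cvg E) K.
Unshelve. all: by end_near. Qed.

End LinearAlgebra.

Section LaurentSeries.
Context {R : realType}.

(* A two-sided series converges when its parts of nonnegative and of negative
   index both do; recall that [Negz m] is the integer -(m+1). *)
Definition is_cvg_bisum (V : normedModType R) (F : int -> V) : Prop :=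
  cvgn (series (fun m => F (Posz m))) /\ cvgn (series (fun m => F (Negz m))).

Definition bisum (V : normedModType R) (F : int -> V) : V :=
  limn (series (fun m => F (Posz m))) + limn (series (fun m => F (Negz m))).

(* Only the values of psi on [lo, hi] matter: the expansion at an endpoint is
   required on the side of the interval. *)
Definition real_analytic_on (lo hi : R) (psi : R -> R) : Prop :=
  forall z0, lo <= z0 <= hi ->
    exists (a : nat -> R) (r : R), 0 < r /\
      forall z, lo <= z <= hi -> `|z - z0| < r ->
        series (fun m => a m * (z - z0) ^+ m) @ \oo --> psi z.

Definition admissible (lo hi : R) (psi : R -> R) (c : int -> R) : Prop :=
  real_analytic_on lo hi psi /\
  forall z, lo <= z <= hi ->
    [/\ is_cvg_bisum (fun j => c j * z ^ j : R^o),
        psi z = bisum (fun j => c j * z ^ j : R^o) & 0 < psi z].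

Definition laurent_mx n (c : int -> R) (A : 'M[R]_n.+1) : 'M[R]_n.+1 :=
  bisum (fun j => c j *: A ^ j).

Definition is_quadratic (f : R -> R) : Prop :=
  exists p2 p1 p0, p2 != 0 /\ forall t, f t = p2 * t ^+ 2 + p1 * t + p0.

End LaurentSeries.

(* A gradient method is determined by its stepsizes, which may depend on the
   objective, on the starting point and on the iteration number j >= 1 (hence
   on the whole history of the run). *)
Definition gradient_method (R : realType) (n : nat) : Type :=
  ('cV[R]_n -> R) -> 'cV[R]_n -> nat -> R.

Section GradientMethod.
Context {R : realType} {n : nat}.

(* The value [x 0] is unused: iterates are numbered from 1. *)
Definition run_of (M : gradient_method R n.+1) (f : 'cV[R]_n.+1 -> R)
    (x : nat -> 'cV[R]_n.+1) : Prop :=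
  forall j, (0 < j)%N -> x j.+1 = x j - M f (x 1%N) j *: gradient f (x j).

Definition orthogonally_invariant (M : gradient_method R n.+1) : Prop :=
  forall (A Q : 'M[R]_n.+1) (b : 'cV[R]_n.+1) (x y : nat -> 'cV[R]_n.+1),
    spd A -> orthogonal_mx Q ->
    let q := quad A b in
    let qhat := fun z => q (Q^T *m z) in
    run_of M q x -> run_of M qhat y -> y 1%N = Q *m x 1%N ->
    forall j, (0 < j)%N ->
      y j = Q *m x j /\ M qhat (y 1%N) j = M q (x 1%N) j.

End GradientMethod.

(* Main.v *)
Require Import Defs.
From HB Require Import structures.
From mathcomp Require Import all_boot all_order all_algebra.
From mathcomp Require Import all_classical all_reals all_analysis.
From mathcomp Require Import ring.

Set Implicit Arguments.
Unset Strict Implicit.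
Unset Printing Implicit Defensive.

Import Order.TTheory GRing.Theory Num.Theory.
Import numFieldNormedType.Exports.

Local Open Scope ring_scope.

(** Write [A] as [P^T D P] with [P] orthogonal and [D] diagonal, with diagonal
entries [d0] and [d1], and measure vectors in the coordinates given by [P].
A convergent Laurent series in [A] then acts as multiplication of the
coordinate number [i] by [psi d_i] ([laurent_mx_orthodiag]).  Let [p], [r] be
the coordinates of the two gradients numbered by [nu1] and [nu2], and [s] those
of [(I - t A) g_k], so that [s_i] is a multiple of [1 - t d_i].  The difference
of the two sides of the stepsize equation at [t] is a quadratic form in
[s_0, s_1].  The coefficient of [s_i^2] is
[p_i r_i (psi1 psi2 - psi3 psi4) (d_i)], which vanishes; only the cross term
[K s_0 s_1] survives, and [K] does not depend on [t].  If the equation is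
genuinely quadratic then [K] is nonzero, so at a root [s_0 = 0] or [s_1 = 0]:
the stepsize [alpha_k] is [1/d0] or [1/d1] unless a coordinate of [g_k] was
already zero, and in every case [g_(k+1)] lies on an eigenline
([quadratic_stepsize_eigenvector]).  When [g_k] is itself an eigenvector (or
zero) the same conclusion is immediate, since a gradient step preserves each
eigenspace ([gradient_step_eigenvector]).

Once [A g_(k+1) = l g_(k+1)], also [A g_(k+2) = l g_(k+2)].  As [A^mu] is
injective and commutes with [A], the vector [w = A^mu g_(k+i)] is a nonzero
eigenvector for the same [l] ([rpowmx_eigenvector]), so the quotient defining
[alpha_(k+2)] equals [1/l] ([rayleigh_eigenvector]), and the step of length
[1/l] along an eigenvector annihilates the gradient: [g_(k+3) = 0]. *)

(** * The dot product *)

Section DotProduct.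
Context {R : realType} {n : nat}.
Implicit Types (u v : 'cV[R]_n.+1).

Lemma dotvE u v : dotv u v = \sum_i u i 0 * v i 0.
Proof. by rewrite /dotv mxE; apply: eq_bigr => i _; rewrite mxE. Qed.

Lemma dotv_gt0 v : v != 0 -> 0 < dotv v v.
Proof.
move=> v0; have [i vi0] : exists i, v i 0 != 0.
  apply/existsP; apply: contraNT v0 => /existsPn v0; apply/eqP/colP => i.
  by rewrite mxE; apply/eqP; rewrite -[_ == _]negbK v0.
rewrite dotvE (bigD1 i) //= ltr_pwDl //.
  by rewrite -expr2 exprn_even_gt0.
by apply: sumr_ge0 => j _; rewrite -expr2 sqr_ge0.
Qed.

Lemma dotvZr (a : R) u v : dotv u (a *: v) = a * dotv u v.
Proof. by rewrite /dotv -scalemxAr mxE. Qed.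

End DotProduct.

(** * Functions of an orthogonally diagonalized matrix *)

Section OrthogonalDiagonalization.
Local Open Scope classical_set_scope.
Local Open Scope ring_scope.
Context {R : realType} {n : nat}.
Implicit Types (P : 'M[R]_n.+1) (d e : 'rV[R]_n.+1) (u v : 'cV[R]_n.+1).

Definition orthodiag P d : 'M[R]_n.+1 := P^T *m diag_mx d *m P.

Lemma orthogonal_mxr P : orthogonal_mx P -> P *m P^T = 1%:M.
Proof. exact: mulmx1C. Qed.

Lemma orthodiagM P d e : orthogonal_mx P ->
  orthodiag P d *m orthodiag P e = orthodiag P (\row_j (d 0 j * e 0 j)).
Proof.
move=> /orthogonal_mxr oP; rewrite /orthodiag -mulmx_diag !mulmxA.
by rewrite -[_ *m P *m P^T]mulmxA oP mulmx1.
Qed.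

Lemma orthodiag_commute P d e : orthogonal_mx P ->
  orthodiag P d *m orthodiag P e = orthodiag P e *m orthodiag P d.
Proof.
move=> oP; rewrite !orthodiagM //; congr (orthodiag P _).
by apply/rowP => j; rewrite !mxE mulrC.
Qed.

Lemma orthodiag1 P : orthogonal_mx P -> orthodiag P (const_mx 1) = 1%:M.
Proof. by move=> oP; rewrite /orthodiag diag_const_mx mulmx1. Qed.

Lemma orthodiag_inv P d : orthogonal_mx P -> (forall i, d 0 i != 0) ->
  orthodiag P d \is a GRing.unit /\
  (orthodiag P d)^-1 = orthodiag P (map_mx GRing.inv d).
Proof.
move=> oP d0.
have dV : orthodiag P d * orthodiag P (map_mx GRing.inv d) = 1.
  rewrite [LHS]orthodiagM // -[RHS](orthodiag1 oP); congr (orthodiag P _).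
  by apply/rowP => j; rewrite !mxE mulfV.
have [ud _] := mulmx1_unit dV; split=> //.
by rewrite -[LHS]mulr1 -dV mulKr.
Qed.

Lemma orthodiagX P d m : orthogonal_mx P ->
  orthodiag P d ^+ m = orthodiag P (map_mx (fun t => t ^+ m) d).
Proof.
move=> oP; elim: m => [|m IHm].
  rewrite expr0 -[LHS](orthodiag1 oP); congr (orthodiag P _).
  by apply/rowP => j; rewrite !mxE.
rewrite exprS IHm [LHS]orthodiagM //; congr (orthodiag P _).
by apply/rowP => j; rewrite !mxE exprS.
Qed.

Lemma orthodiag_exprz P d (j : int) :
  orthogonal_mx P -> (forall i, d 0 i != 0) ->
  orthodiag P d ^ j = orthodiag P (map_mx (fun t => t ^ j) d).
Proof.
move=> oP d0; case: j => m; first exact: orthodiagX.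
rewrite NegzE -exprz_inv (orthodiag_inv oP d0).2 -exprnP orthodiagX //.
congr (orthodiag P _); apply/rowP => i.
by rewrite !mxE -exprz_inv.
Qed.

(** The spectral decomposition of the matrix as a combination of fixed
projectors: it reduces limits of matrices with a common eigenbasis to limits
of their eigenvalues. *)
Lemma orthodiag_sum P d :
  orthodiag P d = \sum_i d 0 i *: orthodiag P (delta_mx 0 i).
Proof.
rewrite {1}/orthodiag {1}[d]row_sum_delta linear_sum /= mulmx_sumr mulmx_suml.
by apply: eq_bigr => i _; rewrite linearZ /= -scalemxAr -scalemxAl.
Qed.

Lemma cvg_orthodiag P (f : nat -> 'rV[R]_n.+1) d :
  (forall i, (fun N => f N 0 i : R^o) @ \oo --> (d 0 i : R^o)) ->
  (fun N => orthodiag P (f N)) @ \oo --> orthodiag P d.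
Proof.
move=> fd; rewrite orthodiag_sum.
under eq_fun do rewrite orthodiag_sum.
apply: cvg_big => [|i _]; first exact: add_continuous.
by apply: cvgZr_tmp; exact: fd.
Qed.

Lemma series_orthodiag P (c : nat -> R) (f : nat -> 'rV[R]_n.+1) N :
  series (fun m => c m *: orthodiag P (f m)) N =
  orthodiag P (\row_i series (fun m => c m * f m 0 i) N).
Proof.
rewrite /series /= orthodiag_sum.
under eq_bigr => m _ do rewrite orthodiag_sum scaler_sumr.
rewrite exchange_big /=; apply: eq_bigr => i _.
by rewrite mxE scaler_suml; apply: eq_bigr => m _; rewrite scalerA.
Qed.

(** Each partial sum of the matrix series has the eigenbasis of the matrix, and
its eigenvalues are the partial sums of the scalar series.  Convergence of the
scalar series at each eigenvalue hence gives convergence of the matrix series,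
without which its [lim] would be arbitrary. *)
Lemma laurent_mx_orthodiag P d (psi : R -> R) (c : int -> R) :
  orthogonal_mx P -> (forall i, d 0 i != 0) ->
  (forall i, is_cvg_bisum (fun j => c j * (d 0 i) ^ j : R^o) /\
             psi (d 0 i) = bisum (fun j => c j * (d 0 i) ^ j : R^o)) ->
  laurent_mx c (orthodiag P d) = orthodiag P (map_mx psi d).
Proof.
move=> oP d0 cvgc.
(* used with [h] the constructors [Posz] and [Negz] *)
have half (h : nat -> int) :
    (forall i, cvgn (series (fun m => c (h m) * (d 0 i) ^ (h m) : R^o))) ->
    limn (series (fun m => c (h m) *: orthodiag P d ^ (h m))) =
    orthodiag P (\row_i limn (series (fun m => c (h m) * (d 0 i) ^ (h m) : R^o))).
  move=> ch; apply: cvg_lim => //.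
  have -> : series (fun m => c (h m) *: orthodiag P d ^ (h m)) = fun N =>
      orthodiag P (\row_i series (fun m => c (h m) * (d 0 i) ^ (h m)) N).
    apply/funext => N.
    have -> : (fun m => c (h m) *: orthodiag P d ^ (h m)) = fun m =>
        c (h m) *: orthodiag P (map_mx (fun t => t ^ (h m)) d).
      by apply/funext => m; rewrite orthodiag_exprz.
    rewrite series_orthodiag; congr (orthodiag P _); apply/rowP => i.
    by rewrite !mxE; congr (series _ N); apply/funext => m; rewrite mxE.
  apply: cvg_orthodiag => i; rewrite mxE.
  by under eq_fun do rewrite mxE; exact: ch.
rewrite /laurent_mx /bisum (half Posz) => [|i]; last by case: (cvgc i) => -[].
rewrite (half Negz) => [|i]; last by case: (cvgc i) => -[].
rewrite /orthodiag -mulmxDl -mulmxDr -linearD /=; congr (_ *m diag_mx _ *m _).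
by apply/rowP => i; rewrite !mxE (cvgc i).2.
Qed.

Lemma dotv_orthodiag P d u v :
  dotv u (orthodiag P d *m v) =
  \sum_i d 0 i * (P *m u) i 0 * (P *m v) i 0.
Proof.
have -> : dotv u (orthodiag P d *m v) = dotv (P *m u) (diag_mx d *m (P *m v)).
  by rewrite /dotv /orthodiag trmx_mul !mulmxA.
rewrite dotvE; apply: eq_bigr => i _.
by rewrite mul_diag_mx [X in _ * X]mxE mulrCA mulrA.
Qed.

Lemma mul_orthodiag P d v i : orthogonal_mx P ->
  (P *m (orthodiag P d *m v)) i 0 = d 0 i * (P *m v) i 0.
Proof.
move=> /orthogonal_mxr oP.
by rewrite /orthodiag !mulmxA oP mul1mx -mulmxA mul_diag_mx mxE.
Qed.

Lemma eigenvalue_orthodiag P d i :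
  orthogonal_mx P -> eigenvalue (orthodiag P d) (d 0 i).
Proof.
move=> oP; apply/eigenvalueP; exists (row i P).
  rewrite -row_mul /orthodiag !mulmxA (orthogonal_mxr oP) mul1mx.
  by apply/rowP => j; rewrite mul_diag_mx !mxE.
apply/eqP => Pi0; have := congr1 (fun B : 'M[R]_n.+1 => B i i) (orthogonal_mxr oP).
rewrite !mxE eqxx big1 => [/eqP|j _]; first by rewrite eq_sym oner_eq0.
by move/rowP/(_ j): Pi0; rewrite !mxE => ->; rewrite mul0r.
Qed.

End OrthogonalDiagonalization.
(** * Eigenvectors of a positive definite matrix and of its powers *)

Section SpdMatrix.
Context {R : realType} {n : nat}.
Implicit Types (A B : 'M[R]_n.+1) (v : 'cV[R]_n.+1).

Lemma spd_eigenvector_gt0 A v l :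
  spd A -> v != 0 -> A *m v = l *: v -> 0 < l.
Proof.
move=> [_ Apos] v0 Av; have := Apos v v0.
by rewrite Av dotvZr pmulr_lgt0 // dotv_gt0.
Qed.

Lemma spd_eigenvalue_gt0 A l : spd A -> eigenvalue A l -> 0 < l.
Proof.
move=> spdA /eigenvalueP[v vA v0].
apply: (@spd_eigenvector_gt0 A v^T l) => //.
  by apply: contraNneq v0 => vT0; rewrite -[v]trmxK vT0 trmx0.
by rewrite -[A in LHS]spdA.1 -trmx_mul vA linearZ.
Qed.

Lemma rayleigh_eigenvector A v l : v != 0 -> A *m v = l *: v ->
  dotv v v / dotv v (A *m v) = l^-1.
Proof.
move=> v0 Av; rewrite Av dotvZr invfM mulrCA mulfV ?mulr1 //.
by rewrite gt_eqF // dotv_gt0.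
Qed.

(** The eigenbasis chosen inside [rpowmx] need not be [P]; the given
diagonalization of [A] only ensures that some choice exists.  Commutation and
injectivity hold for whichever eigenbasis was chosen. *)
Lemma rpowmx_comm_inj A mu (P : 'M[R]_n.+1) (d : 'rV[R]_n.+1) :
  orthogonal_mx P -> (forall i, 0 < d 0 i) -> A = orthodiag P d ->
  A *m rpowmx A mu = rpowmx A mu *m A /\
  (forall v, rpowmx A mu *m v = 0 -> v = 0).
Proof.
move=> oP d0 defA.
have : is_rpowmx A mu (rpowmx A mu).
  by apply: xgetPex; exists (orthodiag P (map_mx (fun t => t `^ mu) d)), P, d.
case=> Q [e [oQ e0 defA' ->]].
split; first by rewrite defA'; exact: orthodiag_commute.
move=> v Bv0; pose f := map_mx (fun t => t `^ mu) e.
have f0 i : f 0 i != 0 by rewrite mxE gt_eqF // powR_gt0.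
have [Bu _] := orthodiag_inv oQ f0.
by rewrite -[v]mul1mx -[1%:M](mulVr Bu) -[_ * _]/(_ *m _) -mulmxA Bv0 mulmx0.
Qed.

Lemma rpowmx_eigenvector A mu (P : 'M[R]_n.+1) (d : 'rV[R]_n.+1) v l :
  orthogonal_mx P -> (forall i, 0 < d 0 i) -> A = orthodiag P d ->
  v != 0 -> A *m v = l *: v ->
  rpowmx A mu *m v != 0 /\
  A *m (rpowmx A mu *m v) = l *: (rpowmx A mu *m v).
Proof.
move=> oP d0 defA v0 Av.
have [AB Binj] := rpowmx_comm_inj mu oP d0 defA.
split; first by apply: contraNneq v0 => /Binj ->.
by rewrite mulmxA AB -mulmxA Av scalemxAr.
Qed.

End SpdMatrix.

(** * The planar case *)

Section Plane.
Context {R : realType}.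
Implicit Types (A P : 'M[R]_2) (d : 'rV[R]_2) (v : 'cV[R]_2).

(** A unit eigenvector [(p, q)] and its quarter turn [(-q, p)] form an
orthonormal basis, and by symmetry the quarter turn is again an eigenvector; its
eigenvalue is read off the trace. *)
Lemma symmetric2_orthodiag A l : A^T = A -> eigenvalue A l ->
  exists P d, orthogonal_mx P /\ A = orthodiag P d.
Proof.
move=> symA /eigenvalueP[v0 v0A v0n].
have vA : v0 *m A = l *: v0 by [].
pose o1 : 'I_2 := lift ord0 ord0.
have I2 (i : 'I_2) : i = 0 \/ i = o1.
  by case: i => -[|[|//]] p; [left | right]; apply/val_inj.
pose r := Num.sqrt (v0 0 0 ^+ 2 + v0 0 o1 ^+ 2).
have sq0 : 0 < v0 0 0 ^+ 2 + v0 0 o1 ^+ 2.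
  rewrite lt_def paddr_eq0 ?sqr_ge0 // addr_ge0 ?sqr_ge0 // andbT !sqrf_eq0.
  apply: contra v0n => /andP[/eqP v00 /eqP v01].
  by apply/eqP/rowP => j; rewrite mxE; case: (I2 j) => ->.
have r0 : r != 0 by rewrite gt_eqF // sqrtr_gt0.
have r2 : r ^+ 2 = v0 0 0 ^+ 2 + v0 0 o1 ^+ 2 by rewrite sqr_sqrtr // ltW.
have A10 : A o1 0 = A 0 o1 by rewrite -[in LHS]symA mxE.
have eq0 : v0 0 0 * A 0 0 + v0 0 o1 * A 0 o1 = l * v0 0 0.
  move/rowP/(_ 0): vA; rewrite !mxE !big_ord_recl big_ord0 addr0.
  by rewrite -/o1 A10.
have eq1 : v0 0 0 * A 0 o1 + v0 0 o1 * A o1 o1 = l * v0 0 o1.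
  by move/rowP/(_ o1): vA; rewrite !mxE !big_ord_recl big_ord0 addr0.
pose p := v0 0 0 / r; pose q := v0 0 o1 / r.
have pq1 : p ^+ 2 + q ^+ 2 = 1.
  by rewrite !expr_div_n -mulrDl -r2 mulfV // expf_neq0.
have {}eq0 : p * A 0 0 + q * A 0 o1 = l * p.
  by rewrite /p /q mulrA -eq0; ring.
have {}eq1 : p * A 0 o1 + q * A o1 o1 = l * q.
  by rewrite /p /q mulrA -eq1; ring.
(* An equality holds as soon as the difference of its sides is a combination of
   the two eigenvector equations and of the normalization; the coefficients are
   supplied for each entry below. *)
have lin u w c0 c1 c2 :
    u = w + c0 * (p * A 0 0 + q * A 0 o1 - l * p)
          + c1 * (p * A 0 o1 + q * A o1 o1 - l * q)
          + c2 * (1 - (p ^+ 2 + q ^+ 2)) -> u = w.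
  by rewrite eq0 eq1 pq1 !subrr !mulr0 !addr0.
exists (\matrix_(i, j) if i == 0 then (if j == 0 then p else q)
                       else (if j == 0 then - q else p)).
exists (\row_j if j == 0 then l else A 0 0 + A o1 o1 - l); split.
  apply/matrixP => i j; rewrite !mxE !big_ord_recl big_ord0 !mxE /=.
  by case: (I2 i) => ->; case: (I2 j) => -> /=; rewrite -?pq1; ring.
rewrite /orthodiag mul_mx_diag.
apply/matrixP => i j; rewrite !mxE !big_ord_recl big_ord0 !mxE /=.
case: (I2 i) => ->; case: (I2 j) => -> /=; rewrite ?A10.
- by apply: (lin _ _ p (- q) (A 0 0)); ring.
- by apply: (lin _ _ q p (A 0 o1)); ring.
- by apply: (lin _ _ q p (A 0 o1)); ring.
- by apply: (lin _ _ (- p) q (A o1 o1)); ring.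
Qed.

Lemma orthodiag2_eigenvector P d v i j : orthogonal_mx P -> i != j ->
  (P *m v) j 0 = 0 -> orthodiag P d *m v = d 0 i *: v.
Proof.
move=> oP ij vj0.
suff PE : P *m (orthodiag P d *m v) = P *m (d 0 i *: v).
  by rewrite -[LHS]mul1mx -oP -mulmxA PE mulmxA oP mul1mx.
apply/colP => m; rewrite mul_orthodiag // -scalemxAr [RHS]mxE.
have [-> //|mi] := eqVneq m i.
suff -> : m = j by rewrite vj0 !mulr0.
apply/val_inj; move: ij mi; rewrite -!val_eqE /=.
by case: i j m {vj0} => -[|[|?]] ? [[|[|?]] ?] [[|[|?]] ?].
Qed.

(** In eigenbasis coordinates the square terms of [F] cancel, so [F] is a
constant multiple of the product of the two coordinates of
[(I - t A) v]; [F] being a genuine quadratic makes that constant nonzero. *)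
Lemma quadratic_stepsize_eigenvector P d (psi1 psi2 psi3 psi4 : R -> R)
    (u1 u2 v : 'cV[R]_2) (a : R) :
  let A := orthodiag P d in
  let form psi u t :=
    dotv u (orthodiag P (map_mx psi d) *m (1%:M - t *: A) *m v) in
  let F t := form psi1 u1 t * form psi2 u2 t - form psi3 u1 t * form psi4 u2 t in
  orthogonal_mx P ->
  (forall i, psi1 (d 0 i) * psi2 (d 0 i) = psi3 (d 0 i) * psi4 (d 0 i)) ->
  is_quadratic F -> F a = 0 ->
  exists l, A *m (v - a *: (A *m v)) = l *: (v - a *: (A *m v)).
Proof.
move=> A form F oP psiE [p2 [p1 [p0 [p2n0 Fquad]]]] Fa0.
pose o1 : 'I_2 := lift ord0 ord0.
pose s t := P *m (v - t *: (A *m v)).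
have sE t i : s t i 0 = (1 - t * d 0 i) * (P *m v) i 0.
  have subE (w z : 'cV[R]_2) : (w - t *: z) i 0 = w i 0 - t * z i 0.
    by rewrite !mxE.
  by rewrite /s mulmxBr -scalemxAr subE mul_orthodiag //; ring.
have formE psi u t : form psi u t =
    psi (d 0 0) * (P *m u) 0 0 * s t 0 0 + psi (d 0 o1) * (P *m u) o1 0 * s t o1 0.
  rewrite /form -mulmxA mulmxBl mul1mx -scalemxAl dotv_orthodiag.
  by rewrite !big_ord_recl big_ord0 addr0 ![map_mx _ _ 0 _]mxE.
(* the coefficient of the cross term, which does not depend on [t] *)
pose K := (P *m u1) 0 0 * (P *m u2) o1 0 *
    (psi1 (d 0 0) * psi2 (d 0 o1) - psi3 (d 0 0) * psi4 (d 0 o1)) +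
  (P *m u1) o1 0 * (P *m u2) 0 0 *
    (psi1 (d 0 o1) * psi2 (d 0 0) - psi3 (d 0 o1) * psi4 (d 0 0)).
have FE t : F t = K * (s t 0 0 * s t o1 0).
  rewrite /F !formE /K.
  have e0 := psiE 0; have e1 := psiE o1.
  set x0 := s t 0 0; set x1 := s t o1 0.
  transitivity (K * (x0 * x1) +
    (P *m u1) 0 0 * (P *m u2) 0 0 * x0 ^+ 2 *
      (psi1 (d 0 0) * psi2 (d 0 0) - psi3 (d 0 0) * psi4 (d 0 0)) +
    (P *m u1) o1 0 * (P *m u2) o1 0 * x1 ^+ 2 *
      (psi1 (d 0 o1) * psi2 (d 0 o1) - psi3 (d 0 o1) * psi4 (d 0 o1))).
    by rewrite /K; ring.
  by rewrite e0 e1 !subrr !mulr0 !addr0.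
have K0 : K != 0.
  apply: contraNneq p2n0 => K0.
  have F0 t : p2 * t ^+ 2 + p1 * t + p0 = 0 by rewrite -Fquad FE K0 mul0r.
  (* a second difference of the polynomial, taken at -1, 0 and 1 *)
  have -> : p2 = 2^-1 * ((p2 * 1 ^+ 2 + p1 * 1 + p0) +
      (p2 * (-1) ^+ 2 + p1 * (-1) + p0)) - (p2 * 0 ^+ 2 + p1 * 0 + p0).
    by field.
  by rewrite !F0; apply/eqP; ring.
move/eqP: Fa0; rewrite FE !mulf_eq0 (negbTE K0) /=.
case/orP => /eqP sa0.
- by exists (d 0 o1); apply: (@orthodiag2_eigenvector P d _ o1 0).
- by exists (d 0 0); apply: (@orthodiag2_eigenvector P d _ 0 o1).
Qed.

End Plane.

(** * Gradient steps and finite termination *)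

Lemma gradient_step_eigenvector (R : realType) n (A : 'M[R]_n.+1)
    (v : 'cV[R]_n.+1) (a l : R) :
  A *m v = l *: v -> A *m (v - a *: (A *m v)) = l *: (v - a *: (A *m v)).
Proof. by move=> Av; rewrite Av mulmxBr -!scalemxAr Av scalerBr !scalerA mulrC. Qed.

Theorem theorem2p1 (R : realType) (A : 'M[R]_2) (b : 'cV[R]_2)
    (lam1 lamn : R) (M : gradient_method R 2) (x : nat -> 'cV[R]_2)
    (nu1 nu2 : nat -> nat) (k : nat)
    (psi1 psi2 psi3 psi4 : R -> R) (c1 c2 c3 c4 : int -> R) (mu : R) (i : nat) :
  let q := quad A b in
  let alpha := M q (x 1%N) in
  let g := fun j => gradient q (x j) in
  let lhs := fun a : R =>
    dotv (g (nu1 k)) (laurent_mx c1 A *m (1%:M - a *: A) *m g k) *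
    dotv (g (nu2 k)) (laurent_mx c2 A *m (1%:M - a *: A) *m g k) in
  let rhs := fun a : R =>
    dotv (g (nu1 k)) (laurent_mx c3 A *m (1%:M - a *: A) *m g k) *
    dotv (g (nu2 k)) (laurent_mx c4 A *m (1%:M - a *: A) *m g k) in
  let w := rpowmx A mu *m g (k + i)%N in
  spd A ->
  extreme_eigenvalues A lam1 lamn ->
  orthogonally_invariant M ->
  run_of M q x ->
  (1 <= nu1 k <= k)%N -> (1 <= nu2 k <= k)%N ->
  admissible lam1 lamn psi1 c1 -> admissible lam1 lamn psi2 c2 ->
  admissible lam1 lamn psi3 c3 -> admissible lam1 lamn psi4 c4 ->
  (forall z, lam1 <= z <= lamn -> psi1 z * psi2 z = psi3 z * psi4 z) ->
  (* The equation for the stepsize is genuinely quadratic; this is not asked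
     when g k is zero or an eigenvector, for then it holds for every a. *)
  ((forall l, A *m g k <> l *: g k) -> is_quadratic (fun a => lhs a - rhs a)) ->
  lhs (alpha k) = rhs (alpha k) ->
  i = 1%N \/ i = 2%N ->
  (g k.+1 != 0 -> g k.+2 != 0 -> alpha k.+2 = dotv w w / dotv w (A *m w)) ->
  exists2 l : nat, (1 <= l <= 3)%N & g (k + l)%N = 0.
Proof.
move=> q alpha g lhs rhs w spdA [eig1 _ eigb] _ run /andP[nu1_gt0 nu1_le] _
  adm1 adm2 adm3 adm4 psiE quad_eq alpha_k i12 alpha_k2.
have k_gt0 : (0 < k)%N := leq_trans nu1_gt0 nu1_le.
have gE j : g j = A *m x j - b by rewrite /g gradient_quad // spdA.1.
have gS j : (0 < j)%N -> g j.+1 = g j - alpha j *: (A *m g j).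
  by move=> j0; rewrite gE run // mulmxBr -scalemxAr addrAC -gE.
have [P [d [oP defA]]] := symmetric2_orthodiag spdA.1 eig1.
have eigd j : eigenvalue A (d 0 j) by rewrite defA; exact: eigenvalue_orthodiag.
have d_gt0 j : 0 < d 0 j by exact: spd_eigenvalue_gt0 (eigd j).
have laurentE c psi : admissible lam1 lamn psi c ->
    laurent_mx c A = orthodiag P (map_mx psi d).
  move=> [_ adm]; rewrite defA; apply: laurent_mx_orthodiag => // j.
    by rewrite gt_eqF.
  by have [cvg_c psi_c _] := adm _ (eigb _ (eigd j)).
have [l gk1] : exists l, A *m g k.+1 = l *: g k.+1.
  have [[l gk]|not_eig] := pselect (exists l, A *m g k = l *: g k).
    by exists l; rewrite gS //; exact: gradient_step_eigenvector.
  have Fquad : is_quadratic (fun a => lhs a - rhs a).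
    by apply: quad_eq => l gk; apply: not_eig; exists l.
  have Fk : lhs (alpha k) - rhs (alpha k) = 0 by rewrite alpha_k subrr.
  move: Fquad Fk; rewrite gS //.
  rewrite /lhs /rhs (laurentE _ _ adm1) (laurentE _ _ adm2).
  rewrite (laurentE _ _ adm3) (laurentE _ _ adm4) defA.
  apply: quadratic_stepsize_eigenvector => // j.
  by apply: psiE; exact: eigb.
have gk2 : A *m g k.+2 = l *: g k.+2.
  by rewrite gS //; exact: gradient_step_eigenvector.
have [g1_0|g1_n0] := eqVneq (g k.+1) 0.
  by exists 1%N => //; rewrite addn1.
have [g2_0|g2_n0] := eqVneq (g k.+2) 0.
  by exists 2%N => //; rewrite addn2.
exists 3%N => //; rewrite addn3 gS // gk2 (alpha_k2 g1_n0 g2_n0).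
have [wn0 Aw] : w != 0 /\ A *m w = l *: w.
  rewrite /w; case: i12 => ->; rewrite ?addn1 ?addn2;
    exact: rpowmx_eigenvector oP d_gt0 defA _ _.
rewrite (rayleigh_eigenvector wn0 Aw) scalerA mulVf ?scale1r ?subrr //.
by rewrite gt_eqF // (spd_eigenvector_gt0 spdA g1_n0 gk1).
Qed.
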